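(* Let $M_{\mathcal{B}}$ be a canonical rational multicyclic monoid such that $\mathcal{B} \neq \emptyset$. Then there exist constants $N, K \in \mathbb{N}$ such that for all integers $k \geq K$ the set $\mathcal{U}_k(M_{\mathcal{B}})$ is an almost arithmetic progression with difference $d = \min \Delta(M_{\mathcal{B}})$ and bound $N$.
   Context: $\mathbb{N}$ and $\mathbb{N}_0$ are the positive and nonnegative integers. For $q \in \mathbb{Q}_{>0}$, $\mathsf{n}(q)$ and $\mathsf{d}(q)$ are the relatively prime positive integers with $q = \mathsf{n}(q)/\mathsf{d}(q)$. A unit fraction is a number $1/m$ with $m \in \mathbb{N}$, $m>1$. For a finite subset $\mathcal{B} \subseteq \mathbb{Q}_{>0}$, let $M_{\mathcal{B}}$ be the additive submonoid of $\mathbb{Q}_{\geq 0}$ generated by $\{b^k \mid b \in \mathcal{B},\, k \in \mathbb{N}_0\}$. $M_{\mathcal{B}}$ is called the rational multicyclic monoid over $\mathcal{B}$ if $M_{\mathcal{B}'} \subsetneq M_{\mathcal{B}}$ whenever $\mathcal{B}' \subsetneq \mathcal{B}$; it is assumed throughout that no element of $\mathcal{B}$ is a unit fraction. It is canonical if $\mathcal{B} \cap \mathbb{N} = \emptyset$ and $\gcd(\mathsf{d}(b), \mathsf{d}(b')) = 1$ for all distinct $b, b' \in \mathcal{B}$. Let $M$ be an additive submonoid of $\mathbb{Q}_{\geq 0}$ (for instance, $M = M_{\mathcal{B}}$). An atom of $M$ is a nonzero element that is not a sum of two nonzero elements of $M$; $\mathcal{A}(M)$ is the set of atoms. A factorization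 of $x\in M$ is a formal sum (element of the free commutative monoid on $\mathcal{A}(M)$) $a_1 + \cdots + a_k$ of atoms whose sum in $M$ is $x$; its length is $k$. $\mathsf{L}(x)$ is the set of lengths of all factorizations of $x$. For $k \in \mathbb{N}$, $\mathcal{U}_k(M)$ is the set of positive integers $m$ for which there exist $a_1, \ldots, a_k, a_1', \ldots, a_m' \in \mathcal{A}(M)$ with $a_1 + \cdots + a_k = a_1' + \cdots + a_m'$ in $M$. For nonzero $x \in M$, $\Delta(x)$ is the set of positive integers $d$ such that $\mathsf{L}(x) \cap [l, l+d] = \{l, l+d\}$ for some $l \in \mathsf{L}(x)$, and $\Delta(M) := \bigcup_{0 \neq x \in M} \Delta(x)$. For $d \in \mathbb{N}$ and $N \in \mathbb{N}_0$, a set $S \subseteq \mathbb{Z}$ is an almost arithmetic progression with difference $d$ and bound $N$ if $S = y + (S' \cup S^* \cup S'') \subseteq y + d\mathbb{Z}$, where $y \in \mathbb{Z}$, $S^*$ is a nonempty (finite or infinite) arithmetic progression with difference $d$ such that $\min S^* = 0$, $S' \subseteq [-N, -1]$, and $S'' \subseteq \sup S^* + [1, N]$ (with $S'' = \emptyset$ if $S^*$ is infinite). *)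

(* Defs.v *)
From mathcomp Require Import all_boot all_order all_algebra finmap multiset.
From mathcomp Require Import boolp classical_sets cardinality.

Set Implicit Arguments.
Unset Strict Implicit.
Unset Printing Implicit Defensive.

Import Order.TTheory GRing.Theory Num.Theory.
Local Open Scope classical_set_scope.
Local Open Scope ring_scope.

Definition is_min d (T : porderType d) (A : set T) (m : T) : Prop :=
  A m /\ lbound A m.

Definition add_submonoid (M : set rat) : Prop :=
  M 0 /\ (forall x y, M x -> M y -> M (x + y)).

(* For B consisting of positive rationals, the submonoid of rat generated by
   the powers of elements of B lies in the nonnegative rationals, so it does
   not matter in which of the two monoids it is generated. *)
Definition multicyclic_monoid (B : {fset rat}) : set rat :=
  smallest add_submonoid [set x | exists2 b, b \in B & exists k : nat, x = b ^+ k].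

Definition unit_fraction (q : rat) : Prop :=
  exists2 m : nat, (1 < m)%N & q = m%:R^-1.

Definition rational_multicyclic (B : {fset rat}) : Prop :=
  [/\ forall b, b \in B -> 0 < b,
      forall b, b \in B -> ~ unit_fraction b &
      forall B' : {fset rat}, (B' `<` B)%fset ->
        multicyclic_monoid B' `<` multicyclic_monoid B].

Definition canonical (B : {fset rat}) : Prop :=
  (forall b, b \in B -> b \isn't a Num.nat) /\
  (forall b b', b \in B -> b' \in B -> b != b' -> gcdz (denq b) (denq b') = 1).

Definition atoms (M : set rat) : set rat :=
  [set a | [/\ M a, a != 0 &
    forall x y, M x -> M y -> x != 0 -> y != 0 -> a <> x + y]].

Definition factorizations (M : set rat) (x : rat) : set {mset rat}%mset :=
  [set z : {mset rat}%mset | (forall a, a \in z -> atoms M a) /\ \sum_(a <- z) a = x].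

Definition lengths (M : set rat) (x : rat) : set nat :=
  [set size z | z in factorizations M x].

Definition lengths_union (k : nat) (M : set rat) : set nat :=
  [set m | (0 < m)%N /\
    exists (a : 'I_k -> rat) (a' : 'I_m -> rat),
      [/\ forall i, atoms M (a i), forall j, atoms M (a' j) &
          \sum_(i < k) a i = \sum_(j < m) a' j]].

Definition delta_elt (M : set rat) (x : rat) : set nat :=
  [set d | (0 < d)%N /\
    exists2 l, lengths M x l &
      lengths M x `&` [set n | (l <= n <= l + d)%N] = [set l; (l + d)%N]].

Definition delta (M : set rat) : set nat :=
  \bigcup_(x in [set x | M x /\ x != 0]) delta_elt M x.

(* Progressions unbounded below are left out: only those having a minimum are
   used. *)
Definition arith_prog (d : nat) (A : set int) : Prop :=
  A !=set0 /\ exists a : int,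
    (exists n : nat, A = [set a + (d * i)%N%:Z | i in [set i | (i < n)%N]]) \/
    A = [set a + (d * i)%N%:Z | i in [set: nat]].

Definition almost_arith_prog (d N : nat) (S : set int) : Prop :=
  exists (y : int) (S1 S0 S2 : set int),
    [/\ S = [set y + z | z in S1 `|` S0 `|` S2],
        S `<=` [set y + d%:Z * z | z in [set: int]],
        arith_prog d S0 /\ is_min S0 0,
        S1 `<=` [set z | - N%:Z <= z <= -1] &
        (finite_set S0 -> exists2 s, isLub S0 s &
           S2 `<=` [set s + t | t in [set t | 1 <= t <= N%:Z]]) /\
        (infinite_set S0 -> S2 = set0)].

(* Main.v *)
(* The atoms are exactly the powers of the elements of B. Writing b = n/d, the
   exchange of n copies of b^j for d copies of b^(j+1) changes a length by
   |n - d|. Let D be the gcd of these differences. Every atom is 1 modulo D in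
   the localization of the integers at D, so any two lengths of an element agree
   modulo D. Conversely the relation "k and m are lengths of a common element" is
   symmetric and additive, so Bezout gives lengths l and l + D of a common
   element, whence D = min Delta. Moreover min(n, d) and min(n, d) + t |n - d|
   are lengths of a common element for every t; adding copies of the pair
   (l, l + D) and of (1, 1) shows that any two large integers congruent modulo D
   are lengths of a common element. Hence U_k contains all large integers
   congruent to k modulo D, and nothing outside k + D Z. *)
From mathcomp Require Import all_boot all_order all_algebra finmap multiset.
From mathcomp Require Import classical_sets cardinality.
From mathcomp Require Import zify ring lra.
Require Import Defs.
Import Order.TTheory GRing.Theory Num.Theory.
Local Open Scope classical_set_scope.
Local Open Scope ring_scope.

Set Implicit Arguments.
Unset Strict Implicit.
Unset Printing Implicit Defensive.

(** * The localization of the integers at [d] *)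

Definition local_at (d : nat) (x : rat) : Prop :=
  exists2 e : nat, coprime e d & x * e%:R \is a Num.int.

Lemma local_at_int d x : x \is a Num.int -> local_at d x.
Proof. by move=> xZ; exists 1%N; rewrite ?coprime1n // mulr1. Qed.

Lemma local_atM d x y : local_at d x -> local_at d y -> local_at d (x * y).
Proof.
move=> [e ce xe] [f cf yf]; exists (e * f)%N; first by rewrite coprimeMl ce.
by rewrite natrM mulrACA rpredM.
Qed.

Lemma local_atD d x y : local_at d x -> local_at d y -> local_at d (x + y).
Proof.
move=> [e ce xe] [f cf yf]; exists (e * f)%N; first by rewrite coprimeMl ce.
rewrite natrM mulrDl mulrA [y * _]mulrCA rpredD // rpredM //.
all: exact: natr_int.
Qed.

Lemma local_atB d x y : local_at d x -> local_at d y -> local_at d (x - y).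
Proof.
move=> xd yd; rewrite -mulN1r; apply: local_atD => //.
by apply: local_atM => //; apply: local_at_int; rewrite rpredN1.
Qed.

Lemma local_atX d x k : local_at d x -> local_at d (x ^+ k).
Proof.
move=> xd; elim: k => [|k IHk]; first by apply: local_at_int; rewrite expr0.
by rewrite exprS; apply: local_atM.
Qed.

Lemma local_at_frac d a e : coprime e d -> local_at d (a%:R / e%:R).
Proof.
move=> ce; exists e => //; have [->|e0] := eqVneq (e%:R : rat) 0.
  by rewrite mulr0.
by rewrite divfK //; exact: natr_int.
Qed.

(** By Bezout for the coprime numbers [e] and [d ^ k], [x] is an integer combination of the integers
    [x * e] and [x * d ^ k]. *)
Lemma local_at_is_int d x k :
  local_at d x -> x * (d ^ k)%:R \is a Num.int -> x \is a Num.int.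
Proof.
move=> [e ce xe] xd; have := coprimeXr k ce; move: (d ^ k)%N xd => f xf cef.
have /coprimezP[[u v] /= uv] : coprimez e f by [].
have -> : x = x * e%:R * u%:~R + x * f%:R * v%:~R.
  rewrite -!mulrA -mulrDr -[LHS]mulr1; congr (_ * _).
  have : (u * e%:Z + v * f%:Z)%:~R = 1 :> rat by rewrite uv.
  by rewrite rmorphD !rmorphM mulrC [_ * f%:~R]mulrC => ->.
by rewrite rpredD // rpredM // intr_int.
Qed.

(** * Lengths of factorizations, and pairs of lengths of a common element *)

Lemma atoms_gt0 (M : set rat) a : (forall x, M x -> 0 <= x) -> atoms M a -> 0 < a.
Proof. by move=> M0 [Ma a0 _]; rewrite lt0r a0 M0. Qed.

Lemma lengthsP (M : set rat) x k :
  lengths M x k <->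
  exists s : seq rat, [/\ size s = k, forall a, a \in s -> atoms M a & \sum_(a <- s) a = x].
Proof.
split=> [[z [za zx] <-]|[s [<- sa sx]]].
  by exists z.
have ps := perm_eq_seq_mset s.
exists (seq_mset s); last exact: perm_size.
split=> [a|]; first by move=> az; apply: sa; rewrite -(perm_mem ps).
by rewrite (perm_big _ ps).
Qed.

Lemma lengthsD M x y k l :
  lengths M x k -> lengths M y l -> lengths M (x + y) (k + l).
Proof.
move=> /lengthsP[s [<- sa <-]] /lengthsP[t [<- ta <-]]; apply/lengthsP.
exists (s ++ t); split; rewrite ?size_cat ?big_cat //.
by move=> a; rewrite mem_cat => /orP[/sa|/ta].
Qed.

Lemma lengths_atomMn M a k : atoms M a -> lengths M (a *+ k) k.
Proof.
move=> Ma; apply/lengthsP; exists (nseq k a); rewrite size_nseq; split=> //.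
  by move=> c /nseqP[->].
by rewrite big_nseq -Monoid.iteropE /= ; elim: k => //= k IHk; rewrite mulrS IHk.
Qed.

(** Membership of [m] in the union of length sets for [k], freed of the positivity of [m]: this
    makes it symmetric and stable under multiples, including the zeroth. *)
Definition colength (M : set rat) (k m : nat) : Prop :=
  exists2 x, lengths M x k & lengths M x m.

Lemma colengthC M k m : colength M k m -> colength M m k.
Proof. by case=> x; exists x. Qed.

Lemma colengthD M k m k' m' :
  colength M k m -> colength M k' m' -> colength M (k + k') (m + m').
Proof. by move=> [x ? ?] [y ? ?]; exists (x + y); apply: lengthsD. Qed.

Lemma colengthM M k m t : colength M k m -> colength M (t * k) (t * m).
Proof.
move=> km; elim: t => [|t IHt]; last by rewrite !mulSn; apply: colengthD.
by exists 0; apply/lengthsP; exists [::]; rewrite big_nil.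
Qed.

Lemma lengths_unionP M k m : (0 < m)%N -> lengths_union k M m <-> colength M k m.
Proof.
move=> m0; split=> [[_ [a [c [aM cM e]]]]|].
  exists (\sum_i a i); apply/lengthsP.
    exists [seq a i | i <- enum 'I_k]; split; rewrite ?size_map -?enumT ?size_enum_ord //.
      by move=> _ /mapP[i _ ->].
    by rewrite big_map big_enum.
  exists [seq c i | i <- enum 'I_m]; split; rewrite ?size_map -?enumT ?size_enum_ord //.
    by move=> _ /mapP[i _ ->].
  by rewrite big_map big_enum e.
move=> [x /lengthsP[s [sk sM sx]] /lengthsP[t [tm tM tx]]]; split=> //.
exists (fun i => nth 0 s i), (fun i => nth 0 t i); split.
- by move=> i; apply/sM/mem_nth; rewrite sk.
- by move=> i; apply/tM/mem_nth; rewrite tm.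
- transitivity x; first by rewrite -sx (big_nth 0) big_mkord sk.
  by rewrite -tx (big_nth 0) big_mkord tm.
Qed.

(* Each exchange of [n] copies of [b ^+ j] for [d] copies of [b ^+ j.+1] leaves
   enough copies of one power of [b] to make the next one. *)
Lemma colength_progression M b n d t :
    (forall j, atoms M (b ^+ j)) -> b * d%:R = n%:R ->
  colength M (minn n d) (minn n d + t * `|n - d|).
Proof.
move=> bM bdn.
have step j : b ^+ j *+ n = b ^+ j.+1 *+ d.
  by rewrite -[LHS]mulr_natr -bdn -[RHS]mulr_natr exprSr; ring.
have [nd|dn] := leqP n d.
  suff len j : lengths M (b ^+ j *+ n) (n + t * `|n - d|)%N.
    by exists (b ^+ 0 *+ n) => //; apply: lengths_atomMn.
  elim: t j => [|t IHt] j; first by rewrite mul0n addn0; apply: lengths_atomMn.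
  rewrite step -(subnKC nd) mulrnDr.
  have -> : (n + t.+1 * `|n - (n + (d - n))%N|)%N = (n + t * `|n - d| + (d - n))%N by nia.
  by apply: lengthsD; [exact: IHt | exact: lengths_atomMn].
(* When [d < n] lengths grow by lowering the exponent, so the element starts at [b ^+ t] to leave
   room for [t] exchanges. *)
exists (b ^+ t *+ d); first exact: lengths_atomMn.
elim: t => [|t IHt]; first by rewrite mul0n addn0; apply: lengths_atomMn.
rewrite -step -(subnKC (ltnW dn)) mulrnDr.
have -> : (d + t.+1 * `|(d + (n - d))%N - d|)%N = (d + t * `|n - d| + (n - d))%N by nia.
by apply: lengthsD; [exact: IHt | exact: lengths_atomMn].
Qed.

(** The Bezout relation [u * a = v * c + gcdn a c] has natural coefficients; the second pair is used
    in reverse order to subtract [v * c]. *)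
Lemma colength_gcd M a c l l' : (0 < a)%N ->
  colength M l (l + a) -> colength M l' (l' + c) ->
  exists l'', colength M l'' (l'' + gcdn a c).
Proof.
move=> a0 la lc; case: (egcdnP c a0) => u v uv _.
exists (u * l + v * (l' + c))%N.
have := colengthD (colengthM u la) (colengthM v (colengthC lc)).
suff -> : (u * (l + a) + v * l' = u * l + v * (l' + c) + gcdn a c)%N by [].
by rewrite !mulnDr uv; lia.
Qed.

(** * The monoid generated by the powers *)

Lemma multicyclic_gen (B : {fset rat}) b k :
  b \in B -> multicyclic_monoid B (b ^+ k).
Proof. by move=> bB; apply: sub_gen_smallest; exists b => //; exists k. Qed.

Lemma multicyclicD (B : {fset rat}) x y :
  multicyclic_monoid B x -> multicyclic_monoid B y -> multicyclic_monoid B (x + y).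
Proof. by move=> Mx My A AP; have [[_ AD] _] := AP; apply: AD; [exact: Mx|exact: My]. Qed.

Lemma multicyclic0 (B : {fset rat}) : multicyclic_monoid B 0.
Proof. by move=> A [[]]. Qed.

Lemma multicyclic_ind (B : {fset rat}) (P : rat -> Prop) :
    P 0 -> (forall x y, P x -> P y -> P (x + y)) ->
    (forall b k, b \in B -> P (b ^+ k)) ->
  forall x, multicyclic_monoid B x -> P x.
Proof.
move=> P0 PD PX; apply: smallest_sub; first by split.
by move=> _ [b bB [k ->]]; apply: PX.
Qed.

Lemma multicyclic_head (B : {fset rat}) x :
  multicyclic_monoid B x -> x = 0 \/
  exists b j y, [/\ b \in B, multicyclic_monoid B y & x = b ^+ j + y].
Proof.
move=> Mx; suff [] : multicyclic_monoid B x /\ (x = 0 \/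
  exists b j y, [/\ b \in B, multicyclic_monoid B y & x = b ^+ j + y]) by [].
move: x Mx; apply: multicyclic_ind.
- by split; [exact: multicyclic0|left].
- move=> x y [Mx Hx] [My Hy]; split; first exact: multicyclicD.
  case: Hx => [->|[b [j [z [bB Mz ->]]]]]; first by rewrite add0r.
  by right; exists b, j, (z + y); rewrite addrA; split=> //; apply: multicyclicD.
- move=> b k bB; split; first exact: multicyclic_gen.
  by right; exists b, k, 0; rewrite addr0; split=> //; apply: multicyclic0.
Qed.

(** * Numerators and denominators of the generators *)

Section Canonical.
Variable B : {fset rat}.
Hypotheses (hB : rational_multicyclic B) (hcan : canonical B).
Implicit Types (b : rat) (i j k : nat).
Let num b := `|numq b|%N.
Let den b := `|denq b|%N.
Let M := multicyclic_monoid B.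

Lemma gen_gt0 b : b \in B -> 0 < b.
Proof. by case: hB => + _ _; apply. Qed.

Lemma gen_frac b : b \in B -> b = (num b)%:R / (den b)%:R.
Proof.
move=> bB; rewrite -[LHS]divq_num_den /num /den.
by rewrite !natr_absz normr_denq ger0_norm // numq_ge0 ltW // gen_gt0.
Qed.

Lemma gen_coprime b : coprime (num b) (den b).
Proof. exact: coprime_num_den. Qed.

Lemma gen_den_gt1 b : b \in B -> (1 < den b)%N.
Proof.
move=> bB; have d0 : (0 < den b)%N by rewrite absz_gt0 denq_neq0.
rewrite ltn_neqAle d0 andbT; apply/eqP => d1.
case: hcan => /(_ b bB) /negP bN _; apply: bN.
by rewrite (gen_frac bB) -d1 divr1 natr_nat.
Qed.

Lemma gen_num_gt1 b : b \in B -> (1 < num b)%N.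
Proof.
move=> bB; have n0 : (0 < num b)%N by rewrite absz_gt0 numq_eq0 gt_eqF // gen_gt0.
rewrite ltn_neqAle n0 andbT; apply/eqP => n1.
case: hB => _ /(_ b bB) bN _; apply: bN; exists (den b); first exact: gen_den_gt1.
by rewrite {1}(gen_frac bB) -n1 div1r.
Qed.

Lemma den_neq0 b : (den b)%:R != 0 :> rat.
Proof. by rewrite pnatr_eq0 absz_eq0 denq_neq0. Qed.

Lemma gen_neq1 b : b \in B -> b != 1.
Proof. by move=> bB; apply/eqP => b1; have := gen_den_gt1 bB; rewrite b1. Qed.

(** * Powers of generators are atoms *)

Lemma local_at_gen b c : b \in B -> c \in B -> c != b -> local_at (den b) c.
Proof.
move=> bB cB cb; rewrite (gen_frac cB); apply: local_at_frac.
by case: hcan => _ /(_ _ _ cB bB cb) /eqP.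
Qed.

Lemma multicyclic_ge0 x : M x -> 0 <= x.
Proof.
apply: (multicyclic_ind (P := fun y => 0 <= y)) => [//|y z|b k bB]; first exact: addr_ge0.
by rewrite exprn_ge0 // ltW // gen_gt0.
Qed.

(** Meant for [d = den b] and [c] a power of [num b]: the fraction collects the powers of [b] in a
    sum, and [v] those of the other generators, whose denominators are coprime to [d]. *)
Definition split_at (d c : nat) (x : rat) : Prop :=
  exists i j v, [/\ x = (c * i)%:R / (d ^ j)%:R + v, 0 <= v & local_at d v].

Lemma split_at_local d c v : 0 <= v -> local_at d v -> split_at d c v.
Proof. by exists 0%N, 0%N, v; rewrite muln0 mul0r add0r. Qed.

Lemma split_atD d c x y : (0 < d)%N ->
  split_at d c x -> split_at d c y -> split_at d c (x + y).
Proof.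
move=> d0 [i [j [v [-> v0 vd]]]] [i' [j' [v' [-> v'0 v'd]]]].
exists (i * d ^ j' + i' * d ^ j)%N, (j + j')%N, (v + v'); split.
- rewrite !(natrM, natrD, natrX, exprD).
  have : d%:R != 0 :> rat by rewrite pnatr_eq0 -lt0n.
  by move=> dn0; field; rewrite !expf_neq0.
- exact: addr_ge0.
- exact: local_atD.
Qed.

(** As [b < 1], a sum below [b ^+ k] involves only powers of [b] with exponent above [k], and
    [num b ^ k.+1] divides their numerators. *)
Lemma split_at_lt b k x : b \in B -> b < 1 -> M x -> x < b ^+ k ->
  split_at (den b) (num b ^ k.+1) x.
Proof.
move=> bB b1 Mx; suff [_] : 0 <= x /\ (x < b ^+ k -> split_at (den b) (num b ^ k.+1) x) by [].
have b0 := gen_gt0 bB.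
have d0 : (0 < den b)%N by rewrite ltnW // gen_den_gt1.
move: x Mx; apply: multicyclic_ind => [|x y [x0 Hx] [y0 Hy]|c j cB].
- split=> // _; apply: split_at_local => //; apply: local_at_int; exact: rpred0.
- by split; [exact: addr_ge0|move=> xy; apply: split_atD => //; [apply: Hx|apply: Hy]; lra].
- have c0 : 0 <= c ^+ j by rewrite exprn_ge0 // ltW // gen_gt0.
  split=> //; have [->|cb] := eqVneq c b; last first.
    by move=> _; apply: split_at_local => //; apply/local_atX/local_at_gen.
  rewrite ltr_iXn2l // => kj.
  exists (num b ^ (j - k.+1))%N, j, 0; split=> //; last by apply: local_at_int; rewrite rpred0.
  by rewrite addr0 -expnD subnKC // {1}(gen_frac bB) expr_div_n !natrX.
Qed.

(* The local part [v] of a splitting is both a power-of-[den b] fraction and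
   local, hence an integer below [1], and then [num b] divides a power of
   [den b]. *)
Lemma split_at_neq_pow b k i j x : b \in B -> x < 1 ->
    split_at (den b) (num b ^ k.+1) x ->
  b ^+ k <> (num b ^ k.+1 * i)%:R / (den b ^ j)%:R + x.
Proof.
move=> bB x1 [i' [j' [v [xE v0 vd]]]] bE.
have dX m : (den b)%:R ^+ m != 0 :> rat by rewrite expf_neq0 ?den_neq0.
have vE : v = (num b)%:R ^+ k / (den b)%:R ^+ k
   - (num b)%:R ^+ k.+1 * i%:R / (den b)%:R ^+ j
   - (num b)%:R ^+ k.+1 * i'%:R / (den b)%:R ^+ j'.
  have := bE; rewrite xE {1}(gen_frac bB) expr_div_n !(natrM, natrX) => ->.
  by ring.
have vZ : v \is a Num.int.
  apply: (@local_at_is_int (den b) _ (k + j + j')) => //.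
  have -> : v * (den b ^ (k + j + j'))%:R =
      (num b)%:R ^+ k * (den b)%:R ^+ (j + j')
    - (num b)%:R ^+ k.+1 * i%:R * (den b)%:R ^+ (k + j')
    - (num b)%:R ^+ k.+1 * i'%:R * (den b)%:R ^+ (k + j).
    rewrite vE natrX !exprD; field; by rewrite !dX.
  by rewrite -!natrX -!natrM !rpredB // ?natr_int.
have v1 : v < 1.
  have : 0 <= (num b ^ k.+1 * i')%:R / (den b ^ j')%:R :> rat by rewrite divr_ge0 ?ler0n.
  by move: x1; rewrite xE; lra.
have {}v0 : v = 0.
  move: vZ v0 v1 => /intrP[m ->]; rewrite ler0z ltrz1 => m0 m1.
  by have -> : m = 0 by lia.
have : (num b ^ k * den b ^ (j + j') = num b ^ k.+1 * (i * den b ^ (k + j') + i' * den b ^ (k + j)))%N.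
  apply/eqP; rewrite -(eqr_nat rat) !(natrM, natrD, natrX); apply/eqP.
  have : v * (den b)%:R ^+ (k + j + j') = 0 by rewrite v0 mul0r.
  have -> : v * (den b)%:R ^+ (k + j + j') =
      (num b)%:R ^+ k * (den b)%:R ^+ (j + j')
    - (num b)%:R ^+ k.+1 * i%:R * (den b)%:R ^+ (k + j')
    - (num b)%:R ^+ k.+1 * i'%:R * (den b)%:R ^+ (k + j).
    rewrite vE !exprD; field; by rewrite !dX.
  by move=> H; lra.
have n1 := gen_num_gt1 bB.
rewrite expnSr -mulnA => /eqP; rewrite eqn_pmul2l ?expn_gt0 ?(ltnW n1) // => /eqP E.
have : (num b %| den b ^ (j + j'))%N by rewrite E dvdn_mulr.
move: (coprimeXr (j + j') (gen_coprime b)); rewrite /coprime => /eqP + /gcdn_idPl E'.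
by rewrite E' => n1'; rewrite n1' in n1.
Qed.

(** As [b > 1], a sum below [b ^+ k.+1] involves only powers of [b] with exponent at most [k], whose
    denominators divide [den b ^ k]. *)
Lemma local_at_lt b k x : b \in B -> 1 < b -> M x -> x < b ^+ k.+1 ->
  local_at (den b) (x * (den b ^ k)%:R).
Proof.
move=> bB b1 Mx; suff [_] : 0 <= x /\ (x < b ^+ k.+1 -> local_at (den b) (x * (den b ^ k)%:R)) by [].
have dZ m : local_at (den b) m%:R by apply: local_at_int; rewrite natr_int.
move: x Mx; apply: multicyclic_ind => [|x y [x0 Hx] [y0 Hy]|c j cB].
- by split=> // _; rewrite mul0r; apply: (dZ 0%N).
- split; first exact: addr_ge0.
  by move=> xy; rewrite mulrDl; apply: local_atD; [apply: Hx|apply: Hy]; lra.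
- split; first by rewrite exprn_ge0 // ltW // gen_gt0.
  have [->|cb] := eqVneq c b; last first.
    by move=> _; apply: local_atM => //; apply/local_atX/local_at_gen.
  rewrite ltr_eXn2l // ltnS => jk.
  suff -> : b ^+ j * (den b ^ k)%:R = (num b ^ j * den b ^ (k - j))%:R by [].
  rewrite {1}(gen_frac bB) -{1}(subnKC jk) !(natrM, natrX) exprD expr_div_n.
  by field; rewrite expf_neq0 ?den_neq0.
Qed.

Lemma multicyclic_pow_atom b k : b \in B -> atoms M (b ^+ k).
Proof.
move=> bB; split; first exact: multicyclic_gen.
  by rewrite expf_neq0 // gt_eqF // gen_gt0.
move=> x y Mx My x0 y0 bE.
have {}x0 : 0 < x by rewrite lt0r x0 multicyclic_ge0.
have {}y0 : 0 < y by rewrite lt0r y0 multicyclic_ge0.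
case: k bE => [|k] bE.
  (* The element is 1, a power of every generator, so [b] may be replaced by a generator [c]
     occurring in [x]; necessarily [c < 1]. *)
  have [x0'|[c [j [z [cB Mz xE]]]]] := multicyclic_head Mx; first by rewrite x0' ltxx in x0.
  have c0 := gen_gt0 cB; have z0 := multicyclic_ge0 Mz.
  have cj1 : c ^+ j < 1 by move: bE; rewrite expr0 xE; lra.
  have cj0 : 0 < c ^+ j by rewrite exprn_gt0.
  have c1 : c < 1.
    by rewrite ltNge; apply/negP => c1; move: cj1; rewrite ltNge exprn_ege1.
  case: j => [|j] in xE cj1 cj0; first by rewrite expr0 ltxx in cj1.
  apply: (@split_at_neq_pow c 0 (num c ^ j)%N j.+1 (z + y)) => //.
  - by move: bE; rewrite expr0 xE; lra.
  - apply: split_at_lt => //; first exact: multicyclicD.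
    by rewrite expr0; move: bE; rewrite expr0 xE; lra.
  - rewrite expr0 -{1}(expr0 b) bE xE expn1 -expnS !natrX -expr_div_n -(gen_frac cB).
    by rewrite addrA.
have [b1|b1|/eqP] := ltgtP b 1; last by rewrite (negPf (gen_neq1 bB)).
  (* Here [b ^+ k.+1] is itself below 1 and splits because [x] and [y] do, so the set-apart fraction
     is taken to be 0. *)
  have d0 : (0 < den b)%N by rewrite ltnW // gen_den_gt1.
  apply: (@split_at_neq_pow b k.+1 0 0 (b ^+ k.+1)) => //.
  - by rewrite exprn_ilt1 // ltW // gen_gt0.
  - by rewrite bE; apply: split_atD => //; apply: split_at_lt => //; rewrite bE; lra.
  - by rewrite muln0 mul0r add0r.
(* Case [b > 1]: [b ^+ k.+1 * den b ^ k] is local at [den b] and equals [num b ^ k.+1 / den b],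
   hence is an integer, against coprimality. *)
have bd : local_at (den b) (b ^+ k.+1 * (den b ^ k)%:R).
  by rewrite bE mulrDl; apply: local_atD; apply: local_at_lt => //; rewrite bE; lra.
have nE : (num b)%:R ^+ k.+1 = b ^+ k.+1 * (den b ^ k)%:R * (den b)%:R.
  by rewrite -mulrA -natrM -expnSr natrX -exprMn {2}(gen_frac bB) divfK ?den_neq0.
have /intrP[m mE] : b ^+ k.+1 * (den b ^ k)%:R \is a Num.int.
  apply: (local_at_is_int (k := 1)) bd _; rewrite expn1 -nE.
  by rewrite -natrX ?natr_int.
move: nE; rewrite mE -natrX => nE.
have {}nE : (num b ^ k.+1)%N = m * (den b)%:Z :> int.
  by apply: (@intr_inj rat); rewrite rmorphM.
have /gcdn_idPr : (den b %| num b ^ k.+1)%N.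
  by have : (den b %| (num b ^ k.+1)%N%:Z)%Z by rewrite nE dvdz_mull.
have d1 := gen_den_gt1 bB.
by have /eqP -> := coprimeXl k.+1 (gen_coprime b) => d1'; rewrite -d1' in d1.
Qed.

Lemma atoms_multicyclicE a : atoms M a -> exists2 b, b \in B & exists k, a = b ^+ k.
Proof.
move=> [Ma a0 aM]; case: (multicyclic_head Ma) => [a0'|[b [j [y [bB My aE]]]]].
  by rewrite a0' eqxx in a0.
exists b => //; exists j; case: (eqVneq y 0) aE => [->|y0] aE; first by rewrite addr0 in aE.
case: (aM (b ^+ j) y) => //; first exact: multicyclic_gen.
by rewrite expf_neq0 // gt_eqF // gen_gt0.
Qed.

(** * Lengths modulo the gcd of the differences *)

Definition diff_gcd : nat := (\big[gcdn/0]_(b <- B) `|num b - den b|)%N.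
Local Notation D := diff_gcd.

Lemma gcd_dvd b : b \in B -> (D %| `|num b - den b|)%N.
Proof. by move=> bB; rewrite /diff_gcd (big_rem b bB) dvdn_gcdl. Qed.

(** A common divisor of [den b] and [D] divides the difference of [num b] and [den b], hence also
    [num b]. *)
Lemma gcd_coprime_den b : b \in B -> coprime (den b) D.
Proof.
move=> bB; rewrite /coprime -dvdn1 -(eqP (gen_coprime b)) dvdn_gcd dvdn_gcdl andbT.
have cd := dvdn_gcdl (den b) D.
have := dvdn_trans (dvdn_gcdr (den b) D) (gcd_dvd bB).
have [nd|/ltnW dn] := leqP (num b) (den b).
  by rewrite distnEr // dvdn_subr.
by rewrite distnEl // dvdn_subl.
Qed.

Lemma gen_dist_gt0 b : b \in B -> (0 < `|num b - den b|)%N.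
Proof.
move=> bB; rewrite lt0n distn_eq0; apply/eqP => nd.
by have := gen_neq1 bB; rewrite {1}(gen_frac bB) nd divff ?den_neq0 // eqxx.
Qed.

Lemma gcd_gt0 : B <> fset0 -> (0 < D)%N.
Proof.
have [->//|[b bB] _] := fset_0Vmem B.
exact: dvdn_gt0 (gen_dist_gt0 bB) (gcd_dvd bB).
Qed.

(** The congruence of [a] to 1 modulo [D] in the localization. It holds for [b] since [b - 1] is the
    signed difference of [num b] and [den b] over [den b], and passes to powers by induction. *)
Lemma atom_congr1 a : (0 < D)%N -> atoms M a -> local_at D ((a - 1) / D%:R).
Proof.
move=> D0 /atoms_multicyclicE[b bB [k ->]].
have Dn0 : D%:R != 0 :> rat by rewrite pnatr_eq0 -lt0n.
have bD : local_at D b by rewrite (gen_frac bB); apply: local_at_frac; exact: gcd_coprime_den.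
have b1 : local_at D ((b - 1) / D%:R).
  have /dvdnP[q qE] := gcd_dvd bB.
  have qd := local_at_frac q (gcd_coprime_den bB).
  have [nd|/ltnW dn] := leqP (num b) (den b).
    suff -> : (b - 1) / D%:R = 0 - q%:R / (den b)%:R.
      by apply: local_atB => //; apply: local_at_int; rewrite rpred0.
    have nE : (num b)%:R = (den b)%:R - q%:R * D%:R :> rat.
      by rewrite -natrM -qE distnEr // natrB // subKr.
    by rewrite [in LHS](gen_frac bB) nE; field; rewrite Dn0 den_neq0.
  suff -> : (b - 1) / D%:R = q%:R / (den b)%:R by [].
  have nE : (num b)%:R = (den b)%:R + q%:R * D%:R :> rat.
    by rewrite -natrM -natrD -qE distnEl // subnKC.
  by rewrite [in LHS](gen_frac bB) nE; field; rewrite Dn0 den_neq0.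
elim: k => [|k IHk]; first by apply: local_at_int; rewrite expr0 subrr mul0r rpred0.
have -> : (b ^+ k.+1 - 1) / D%:R = b * ((b ^+ k - 1) / D%:R) + (b - 1) / D%:R.
  by rewrite exprS; field.
by apply: local_atD => //; apply: local_atM.
Qed.

Lemma lengths_congr x k : (0 < D)%N -> lengths M x k -> local_at D ((x - k%:R) / D%:R).
Proof.
move=> D0 /lengthsP[s [<- + <-]].
elim: s => [|a s IHs] sM.
  by apply: local_at_int; rewrite big_nil subrr mul0r rpred0.
rewrite big_cons /= -natr1.
have -> : (a + \sum_(c <- s) c - ((size s)%:R + 1)) / D%:R =
    (a - 1) / D%:R + (\sum_(c <- s) c - (size s)%:R) / D%:R.
  by rewrite -mulrDl; congr (_ / _); ring.
apply: local_atD; first by apply: atom_congr1 => //; apply: sM; rewrite mem_head.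
by apply: IHs => c cs; apply: sM; rewrite inE cs orbT.
Qed.

(** Both lengths are congruent to the common element in the localization, and the denominator [e] is
    coprime to [D], so it cancels by the Gauss lemma. *)
Lemma colength_congr k m : (0 < D)%N -> colength M k m -> (D %| k%:Z - m%:Z)%Z.
Proof.
move=> D0 [x xk xm].
have Dn0 : D%:R != 0 :> rat by rewrite pnatr_eq0 -lt0n.
have [e ce] := local_atB (lengths_congr D0 xm) (lengths_congr D0 xk).
have -> : (x - m%:R) / D%:R - (x - k%:R) / D%:R = (k%:R - m%:R) / D%:R :> rat.
  by rewrite -mulrBl; congr (_ / _); ring.
case/intrP => z zE.
have E : (k%:Z - m%:Z) * e%:Z = z * D%:Z.
  by apply: (@intr_inj rat); rewrite !(rmorphM, rmorphB) /= -zE -!pmulrn; field.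
have : (D %| (k%:Z - m%:Z) * e%:Z)%Z by rewrite E dvdz_mull.
by rewrite Gauss_dvdzl ?coprimezE 1?coprime_sym.
Qed.

(** * The minimal distance, and all large pairs of lengths *)

Lemma gcd_colength : exists l, colength M l (l + D).
Proof.
have M1 b : b \in B -> colength M (minn (num b) (den b)) (minn (num b) (den b) + `|num b - den b|).
  move=> bB; rewrite -[X in (_ + X)%N]mul1n; apply: (@colength_progression _ b).
    by move=> j; apply: multicyclic_pow_atom.
  by rewrite {1}(gen_frac bB) divfK ?den_neq0.
rewrite /diff_gcd big_seq; elim/big_ind: _ => [|a c [l la] [l' lc]|b /M1]; last by eexists; eassumption.
  by exists 0%N; exists 0; apply/lengthsP; exists [::]; rewrite big_nil.
(* The Bezout coefficients require a positive first number; [a = 0] does arise, from the empty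
   gcd. *)
case: (posnP a) la => [->|a0] la; first by rewrite gcd0n; exists l'.
exact: colength_gcd la lc.
Qed.

Lemma lengths_multicyclic_gt0 x k : (0 < k)%N -> lengths M x k -> M x /\ 0 < x.
Proof.
move=> k0 /lengthsP[s [sk sM <-]]; rewrite -{}sk in k0.
elim: s k0 sM => // a s IHs _ sM; rewrite big_cons.
have Ma : atoms M a by apply: sM; rewrite mem_head.
have a0 := atoms_gt0 multicyclic_ge0 Ma.
case: s IHs sM => [|c s] IHs sM; first by rewrite big_nil addr0; split=> //; case: Ma.
have [] := IHs isT; first by move=> e es; apply: sM; rewrite inE es orbT.
move=> Ms s0; split; last by rewrite addr_gt0.
by apply: multicyclicD => //; case: Ma.
Qed.

Lemma min_delta : (0 < D)%N -> is_min (delta M) D.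
Proof.
move=> D0; split.
  have [l [x xl xlD]] := gcd_colength; exists x.
    have [|Mx x0] := lengths_multicyclic_gt0 _ xlD; first by rewrite addn_gt0 D0 orbT.
    by split; rewrite // gt_eqF.
  split=> //; exists l => //; apply/seteqP; split=> [n [xn /andP[ln nl]]|n].
    have xln : colength M n l by exists x.
    (* A length in the interval differs from [l] by a multiple of [D] that is at most [D], so it is
       an endpoint. *)
    have /dvdnP[q qE] : (D %| n - l)%N.
      by have := colength_congr D0 xln; rewrite -{1}(subnK ln) PoszD addrK.
    have q1 : (q <= 1)%N by rewrite -(leq_pmul2r D0) -qE; lia.
    by case: q q1 qE => [|[|//]] _ qE; [left|right]; rewrite /=; lia.
  by case=> ->; split=> //=; rewrite ?leqnn ?leq_addr.
move=> d [x _ [d0 [l xl lE]]].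
have [xld _] : (lengths M x `&` [set n | (l <= n <= l + d)%N]) (l + d)%N by rewrite lE; right.
have : colength M (l + d) l by exists x.
by move/(colength_congr D0); rewrite PoszD addrC addKr => /dvdn_leq; apply.
Qed.

Lemma colength_large : (0 < D)%N -> B <> fset0 -> exists2 K, (0 < K)%N &
  forall k m, (K <= k)%N -> (K <= m)%N -> (D %| k%:Z - m%:Z)%Z -> colength M k m.
Proof.
move=> D0; have [->//|[b bB] _] := fset_0Vmem B.
have [l lD] := gcd_colength.
have /dvdnP[q qE] := gcd_dvd bB.
have bj j := multicyclic_pow_atom j bB.
have M11 k : colength M k k.
  by exists (b ^+ 0 *+ k); apply: lengths_atomMn.
pose mu := minn (num b) (den b).
have mu0 : (0 < mu)%N by rewrite leq_min (ltnW (gen_num_gt1 bB)) ltnW // gen_den_gt1.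
have q0 : (0 < q)%N.
  by have := gen_dist_gt0 bB; rewrite qE muln_gt0 => /andP[].
(* Write [m - k = t * D], where [q * D] is the difference for [b]. The progression of [b] from [mu]
   provides [t %/ q] steps of [q * D], and [t %% q < q] copies of [(l, l + D)] the rest; this uses
   length at most [mu + q * l], and equal atoms on both sides fill up to [k]. *)
exists (mu + q * l)%N; first by rewrite addn_gt0 mu0.
move=> k m; wlog km : k m / (k <= m)%N => [H|] kK mK.
  have [|/ltnW] := leqP k m; first by move=> km; exact: H.
  by move=> mk Dkm; apply/colengthC/H => //; rewrite -rpredN opprB.
rewrite -rpredN opprB -{1}(subnK km) PoszD addrK => Dmk.
have /dvdnP[t tE] : (D %| m - k)%N by [].
have bK : b * (den b)%:R = (num b)%:R by rewrite {1}(gen_frac bB) divfK ?den_neq0.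
have := colengthD (colengthD (colength_progression (t %/ q) bj bK)
  (colengthM (t %% q) lD)) (M11 (k - mu - (t %% q) * l)%N).
have tq : (t %% q * l <= q * l)%N by rewrite leq_mul2r ltnW ?orbT // ltn_mod.
rewrite -/mu qE.
congr (colength _ _ _); first by lia.
rewrite -(subnK km) tE [in RHS](divn_eq t q) mulnA mulnDr mulnDl; lia.
Qed.

End Canonical.

(** * From all large numbers in a residue class to an almost arithmetic progression *)

Lemma almost_arith_prog_tail (d K k : nat) (U : set nat) :
    (0 < d)%N -> (K <= k)%N ->
    (forall m, U m -> (d %| k%:Z - m%:Z)%Z) ->
    (forall m, (K <= m)%N -> (d %| k%:Z - m%:Z)%Z -> U m) ->
  almost_arith_prog d (K + d) [set m%:Z | m in U].
Proof.
(* The least number at least [K] congruent to [k] modulo [d]: from [y] on, [U] is the full residue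
   class. *)
move=> d0 Kk Ud dU; pose y := (K + (k - K) %% d)%N.
have ky : k = (y + (k - K) %/ d * d)%N by rewrite /y; have := divn_eq (k - K) d; lia.
have yK : (y < K + d)%N by rewrite ltn_add2l ltn_mod.
(* The members of [U] below [y] are natural numbers, so their offsets from [y] are at least [-y],
   within the bound because [y < K + d]. *)
pose S1 := [set z : int | z < 0 /\ exists2 m, U m & m%:Z = y%:Z + z].
pose S0 := [set (0 : int) + (d * i)%N%:Z | i in [set: nat]].
have Uy m : U m -> exists z : int, m%:Z = y%:Z + d%:Z * z.
  by move=> /Ud /dvdzP[z zE]; exists (((k - K) %/ d)%N%:Z - z); rewrite ky in zE; lia.
(* Infinitude makes the upper exceptional part empty; it follows from the injectivity of
   multiplication by [d > 0]. *)
have S0inf : infinite_set S0.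
  move=> S0f; apply: infinite_nat.
  have := finite_preimage (f := fun i => (0 : int) + (d * i)%N%:Z) _ S0f.
  rewrite (_ : _ @^-1` _ = setT); last by apply/seteqP; split=> // i _; exists i.
  by apply=> i j _ _; nia.
exists y%:Z, S1, S0, set0; split.
- rewrite setU0; apply/seteqP; split=> [_ [m Um <-]|_ [z [[z0 [m Um mE]]|[i _ <-]] <-]].
  + have [z zE] := Uy m Um; exists (m%:Z - y%:Z); last by lia.
    have [my|ym] := ltnP m y; [left|right].
      by split; [lia|exists m => //; lia].
    by exists `|z|%N => //; nia.
  + by exists m; rewrite -?mE.
  + exists (y + d * i)%N; last by rewrite add0r.
    apply: dU; first by rewrite /y; lia.
    by apply/dvdzP; exists (((k - K) %/ d)%N%:Z - i%:Z); rewrite [in LHS]ky; lia.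
- by move=> _ [m /Uy[z zE] <-]; exists z.
- split; first by split; [exists 0, 0%N; rewrite ?muln0|exists 0; right].
  split; first by exists 0%N => //; rewrite muln0.
  by move=> _ [i _ <-]; rewrite add0r.
- by move=> z [z0 [m _ mE]] /=; apply/andP; lia.
- by split.
Qed.

Unset Implicit Arguments.

Theorem proposition4p11 (B : {fset rat})
    (hB : rational_multicyclic B) (hcan : canonical B) (hne : B <> fset0) :
  exists d : nat, is_min (delta (multicyclic_monoid B)) d /\
    exists N K : nat, [/\ (0 < N)%N, (0 < K)%N &
      forall k : nat, (K <= k)%N ->
        almost_arith_prog d N
          [set m%:Z | m in lengths_union k (multicyclic_monoid B)]].
Proof.
have D0 := gcd_gt0 hB hcan hne.
exists (diff_gcd B); split; first exact: min_delta hB hcan D0.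
have [K K0 HK] := colength_large hB hcan D0 hne.
exists (K + diff_gcd B)%N, K; split=> //; first by rewrite addn_gt0 K0.
move=> k kK; apply: (almost_arith_prog_tail D0 kK) => m.
  move=> Um; apply: (colength_congr hB D0).
  by apply/lengths_unionP => //; case: Um.
move=> mK /(HK _ _ kK mK) km; apply/lengths_unionP => //.
exact: leq_trans mK.
Qed.
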